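(* For any $l,m,n\in\mathbb{N}$ (positive integers), $K_{l,m,n}\in\mathfrak{N}_{c}$ and $w_{c}(K_{l,m,n})\leq l+m+n$.
   Context: $K_{l,m,n}$ is the complete tripartite graph with parts of sizes $l$, $m$ and $n$. For a finite simple graph $G$ and a positive integer $t$, an interval cyclic $t$-coloring of $G$ is a proper edge-coloring of $G$ with colors $1,\ldots,t$ such that all $t$ colors are used and, for each vertex $v$, the edges incident to $v$ are colored by $d_{G}(v)$ consecutive colors modulo $t$ (i.e. consecutive in the cyclic order $1,2,\ldots,t,1$), where $d_G(v)$ is the degree of $v$. $\mathfrak{N}_{c}$ is the set of graphs having an interval cyclic $t$-coloring for some positive integer $t$. For $G\in\mathfrak{N}_{c}$, $w_{c}(G)$ is the least $t$ for which $G$ has an interval cyclic $t$-coloring. *)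

(* Defs.v *)
From mathcomp Require Import all_boot.
From mathcomp Require Import boolp.

Set Implicit Arguments.
Unset Strict Implicit.
Unset Printing Implicit Defensive.

Record sgraph := SGraph {
  vertex :> finType;
  adj : rel vertex;
  adj_sym : symmetric adj;
  adj_irrefl : irreflexive adj
}.

Definition edges (G : sgraph) : {set {set G}} :=
  [set e | [exists x : G, exists y : G, adj x y && (e == [set x; y])]].

Definition degree (G : sgraph) (v : G) : nat := #|[set u | adj v u]|.

(* Colourings are total functions on vertex sets; only their values on
   [edges G] matter. *)
Definition proper_edge_coloring (G : sgraph) (c : {set G} -> nat) : Prop :=
  forall e f : {set G}, e \in edges G -> f \in edges G ->
    e != f -> e :&: f != set0 -> c e <> c f.

(* Colours run from 1 to t, hence the successor: the d colours following
   cyclically from (a mod t) + 1. *)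
Definition cyclic_interval (t a d k : nat) : Prop :=
  exists2 i, i < d & k = ((a + i) %% t).+1.

(* Properness makes the colours at v pairwise distinct, so the last clause
   forces [degree v <= t] and the interval consists of exactly [degree v]
   colours. *)
Definition interval_cyclic_coloring (G : sgraph) (t : nat)
    (c : {set G} -> nat) : Prop :=
  [/\ proper_edge_coloring c,
      forall e, e \in edges G -> 1 <= c e <= t,
      forall k, 1 <= k <= t -> exists2 e, e \in edges G & c e = k
    & forall v : G, exists a : nat, forall k : nat,
        (exists e, [/\ e \in edges G, v \in e & c e = k])
        <-> cyclic_interval t a (degree v) k].

Definition has_interval_cyclic_coloring (G : sgraph) (t : nat) : Prop :=
  0 < t /\ exists c : {set G} -> nat, interval_cyclic_coloring t c.

Definition Nc (G : sgraph) : Prop := exists t, has_interval_cyclic_coloring G t.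

Lemma Nc_asbool (G : sgraph) :
  Nc G -> exists t, `[< has_interval_cyclic_coloring G t >].
Proof. by case=> t Gt; exists t; apply/asboolP. Qed.

Definition w_c (G : sgraph) (GNc : Nc G) : nat := ex_minn (Nc_asbool GNc).

Definition tripart (l m n : nat) (x : 'I_l + 'I_m + 'I_n) : 'I_3 :=
  match x with
  | inl (inl _) => @Ordinal 3 0 isT
  | inl (inr _) => @Ordinal 3 1 isT
  | inr _ => @Ordinal 3 2 isT
  end.

Definition tripart_adj (l m n : nat) : rel ('I_l + 'I_m + 'I_n) :=
  fun x y => tripart x != tripart y.

Lemma tripart_adj_sym (l m n : nat) : symmetric (@tripart_adj l m n).
Proof. by move=> x y; rewrite /tripart_adj eq_sym. Qed.

Lemma tripart_adj_irrefl (l m n : nat) : irreflexive (@tripart_adj l m n).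
Proof. by move=> x; rewrite /tripart_adj eqxx. Qed.

Definition complete_tripartite (l m n : nat) : sgraph :=
  SGraph (@tripart_adj_sym l m n) (@tripart_adj_irrefl l m n).

(* Main.v *)
Require Import Defs.
From mathcomp Require Import all_boot.
From mathcomp Require Import boolp zify.

(** Write [a_i], [b_j], [c_k] (indices from 0) for the vertices of the parts
    of sizes [l], [m], [n], and put [t = l + m + n]. With colours taken in
    [Z/t], colour

      [a_i b_j] by [i + j],  [a_i c_k] by [i + k + m],
      [b_j c_k] by [j + k + l + m].

    Then [a_i] sees the [m] consecutive colours from [i] on, followed by the
    [n] colours from [i + m] on; [c_k] sees the [l] colours from [k + m] on,
    followed by the [m] colours from [k + m + l] on; and [b_j] sees the [n]
    colours from [j + l + m] on, followed by the [l] colours from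
    [j + l + m + n] on, because [l + m + n = 0] in [Z/t]. So every vertex sees
    an interval whose length is its degree, and every colour occurs. Hence
    [K_{l,m,n}] has an interval cyclic [(l + m + n)]-colouring.

    Lemma [interval_cyclic_coloring_of_rank] reduces an interval cyclic
    colouring to numbers attached to ordered pairs of adjacent vertices: the
    edge joining [v] to the neighbour of rank [r] gets the [r]-th colour of the
    interval at [v]. *)

Set Implicit Arguments.
Unset Strict Implicit.
Unset Printing Implicit Defensive.

(** * Colourings given by ranks of neighbours *)

Section RankColoring.

Variable G : sgraph.

(** The colouring of edges, as sets of two vertices, induced by a function of
    two vertices; it is meaningful when that function is symmetric. The value
    0 is taken off the edges. *)
Definition edge_fun (f : G -> G -> nat) (e : {set G}) : nat :=
  if [pick p : G * G | adj p.1 p.2 && (e == [set p.1; p.2])] is Some p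
  then f p.1 p.2 else 0.

Lemma adj_neq (x y : G) : adj x y -> x != y.
Proof. by apply: contraTneq => ->; rewrite adj_irrefl. Qed.

Lemma edge_funE (f : G -> G -> nat) (x y : G) :
  (forall u v, f u v = f v u) -> adj x y -> edge_fun f [set x; y] = f x y.
Proof.
move=> f_sym xy; rewrite /edge_fun; case: pickP => [[u v] /=|/(_ (x, y))].
  case/andP=> uv /eqP/setP Exy.
  have := Exy u; have := Exy v; rewrite !inE !eqxx orbT /=.
  have /eqP neq_uv := adj_neq uv.
  by do 2![case/orP=> /eqP ?]; subst.
by rewrite /= xy eqxx.
Qed.

Lemma edgesP (e : {set G}) :
  reflect (exists x y : G, adj x y /\ e = [set x; y]) (e \in edges G).
Proof.
rewrite inE; apply: (iffP existsP) => [[x /existsP[y /andP[xy /eqP->]]]|].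
  by exists x, y.
by case=> x [y [xy ->]]; exists x; apply/existsP; exists y; rewrite xy eqxx.
Qed.

Lemma edges_adj (x y : G) : adj x y -> [set x; y] \in edges G.
Proof. by move=> xy; apply/edgesP; exists x, y. Qed.

Lemma edges_at (v : G) (e : {set G}) :
  e \in edges G -> v \in e -> exists2 u, adj v u & e = [set v; u].
Proof.
move=> /edgesP[x [y [xy ->]]] /set2P[->|->]; first by exists y.
by exists x; rewrite 1?adj_sym 1?setUC.
Qed.

(** An injection of the neighbours of [v] into the numbers below [degree v] is
    onto, by counting. *)
Lemma rank_onto (v : G) (r : G -> nat) (i : nat) :
  (forall u : G, adj v u -> r u < degree v) ->
  (forall u w : G, adj v u -> adj v w -> r u = r w -> u = w) ->
  i < degree v -> exists2 u, adj v u & r u = i.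
Proof.
move=> r_lt r_inj lt_i_d.
pose s := [seq r u | u <- enum [set u | adj v u]].
have s_uniq : uniq s.
  rewrite map_inj_in_uniq ?enum_uniq // => u w.
  by rewrite !mem_enum !inE; apply: r_inj.
have s_sub : {subset s <= iota 0 (degree v)}.
  move=> _ /mapP[u + ->]; rewrite mem_enum inE mem_iota => /r_lt.
  by rewrite add0n.
have s_size : size (iota 0 (degree v)) <= size s.
  by rewrite size_iota size_map -cardE.
have [_ /(_ i)] := uniq_min_size s_uniq s_sub s_size.
rewrite mem_iota lt_i_d => /mapP[u].
by rewrite mem_enum inE => vu ->; exists u.
Qed.

(** A colouring is interval cyclic as soon as, at each vertex [v], the
    neighbours [u] have distinct ranks [r v u] below the degree, and the edge
    to [u] gets the colour at cyclic distance [r v u] from [a v]. Properness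
    follows because the degrees do not exceed [t]. *)
Lemma interval_cyclic_coloring_of_rank (t : nat) (f : G -> G -> nat)
    (a : G -> nat) (r : G -> G -> nat) :
  0 < t ->
  (forall u v, f u v = f v u) ->
  (forall v : G, degree v <= t) ->
  (forall v u : G, adj v u -> f v u = ((a v + r v u) %% t).+1) ->
  (forall v u : G, adj v u -> r v u < degree v) ->
  (forall v u w : G, adj v u -> adj v w -> r v u = r v w -> u = w) ->
  (forall k, k < t -> exists u v : G, adj u v /\ f u v = k.+1) ->
  has_interval_cyclic_coloring G t.
Proof.
move=> t_gt0 f_sym deg_le fE r_lt r_inj f_onto; split=> //.
exists (edge_fun f); split.
- move=> e e' Ge Ge' neq_ee' /set0Pn[v]; rewrite inE => /andP[ve ve'].
  have [u vu De] := edges_at Ge ve; have [w vw De'] := edges_at Ge' ve'.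
  rewrite De De' !edge_funE // !fE // => -[/eqP].
  rewrite eqn_modDl !modn_small ?(leq_trans (r_lt _ _ _) (deg_le v)) //.
  by move=> /eqP/(r_inj _ _ _ vu vw) Euw; rewrite De De' Euw eqxx in neq_ee'.
- by move=> e /edgesP[x [y [xy ->]]]; rewrite edge_funE // fE //= ltn_mod.
- case=> // k /f_onto[x [y [xy <-]]].
  by exists [set x; y]; [apply: edges_adj | apply: edge_funE].
move=> v; exists (a v) => k; split=> [[e [Ge ve <-]] | [i lt_i_d ->]].
  have [u vu ->] := edges_at Ge ve.
  by exists (r v u); [apply: r_lt | rewrite edge_funE // fE].
have [u vu <-] := rank_onto (r_lt v) (r_inj v) lt_i_d.
exists [set v; u]; split; first exact: edges_adj.
  by rewrite set21.
by rewrite edge_funE // fE.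
Qed.

End RankColoring.

Lemma w_c_le (G : sgraph) (GNc : Nc G) (t : nat) :
  has_interval_cyclic_coloring G t -> w_c GNc <= t.
Proof.
by move=> Gt; rewrite /w_c; case: ex_minnP => s _; apply; apply/asboolP.
Qed.

(** * The colouring of the complete tripartite graph *)

Section Tripartite.

Variables l m n : nat.

Local Notation K := (complete_tripartite l m n).

Lemma tripart_degree (v : K) :
  degree v = match v with
             | inl (inl _) => m + n
             | inl (inr _) => l + n
             | inr _ => l + m
             end.
Proof.
rewrite /degree -sum1dep_card !big_sumType /=.
by case: v => [[i|j]|k]; rewrite /tripart_adj /= big_pred0_eq
  !sum_nat_const !card_ord !muln1 ?addn0.
Qed.

(** The colour of an edge, as a residue modulo [l + m + n] shifted by one since
    colours start from 1. Values at non-adjacent pairs are irrelevant. *)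
Definition tripart_color (x y : K) : nat :=
  (match x, y with
   | inl (inl i), inl (inr j) | inl (inr j), inl (inl i) => i + j
   | inl (inl i), inr k | inr k, inl (inl i) => i + k + m
   | inl (inr j), inr k | inr k, inl (inr j) => j + k + (l + m)
   | _, _ => 0
   end %% (l + m + n)).+1.

(** The first residue of the interval of colours at a vertex. *)
Definition tripart_start (v : K) : nat :=
  match v with
  | inl (inl i) => i
  | inl (inr j) => j + (l + m)
  | inr k => k + m
  end.

(** The rank of [u] among the neighbours of [v], in the order of their colours.
    Cyclically, each part sees first the next part, then the previous one, the
    parts of sizes [l], [m], [n] being followed by those of sizes [m], [n],
    [l]. *)
Definition tripart_rank (v u : K) : nat :=
  match v, u with
  | inl (inl _), inl (inr j) => j
  | inl (inl _), inr k => m + k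
  | inl (inr _), inr k => k
  | inl (inr _), inl (inl i) => n + i
  | inr _, inl (inl i) => i
  | inr _, inl (inr j) => l + j
  | _, _ => 0
  end.

Lemma tripart_color_sym (x y : K) : tripart_color x y = tripart_color y x.
Proof. by case: x y => [[i|j]|k] [[i'|j']|k']. Qed.

Lemma tripart_color_rank (v u : K) :
  adj v u ->
  tripart_color v u =
    ((tripart_start v + tripart_rank v u) %% (l + m + n)).+1.
Proof.
case: v u => [[i|j]|k] [[i'|j']|k'] //= _; rewrite /tripart_color /=;
  congr (_.+1); try by congr (_ %% _); lia.
(* At a vertex of the second part the interval wraps around. *)
by rewrite -(modnDr (i' + j)); congr (_ %% _); lia.
Qed.

Lemma tripart_rank_lt (v u : K) : adj v u -> tripart_rank v u < degree v.
Proof.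
rewrite tripart_degree.
by case: v u => [[i|j]|k] [[i'|j']|k'] //= _;
  [move: (ltn_ord j') | move: (ltn_ord k') | move: (ltn_ord i')
  | move: (ltn_ord k') | move: (ltn_ord i') | move: (ltn_ord j')]; lia.
Qed.

Lemma tripart_rank_inj (v u w : K) :
  adj v u -> adj v w -> tripart_rank v u = tripart_rank v w -> u = w.
Proof.
case: v u w => [[i|j]|k] [[[i1 lt1]|[j1 lt1]]|[k1 lt1]]
  [[[i2 lt2]|[j2 lt2]]|[k2 lt2]] //= _ _ E; try lia;
  by do ?[congr inl | congr inr]; apply: val_inj => /=; lia.
Qed.

Lemma tripart_color_onto (k : nat) :
  0 < l -> 0 < m -> 0 < n -> k < l + m + n ->
  exists x y : K, adj x y /\ tripart_color x y = k.+1.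
Proof.
move=> l_gt0 m_gt0 n_gt0 lt_k.
have [lt_km|le_mk] := ltnP k m.
  exists (inl (inl (Ordinal l_gt0))), (inl (inr (Ordinal lt_km))).
  by rewrite /tripart_color /= add0n modn_small.
have [lt_klm|le_lmk] := ltnP k (l + m).
  have lt_i : k - m < l by lia.
  exists (inl (inl (Ordinal lt_i))), (inr (Ordinal n_gt0)).
  by rewrite /tripart_color /= addn0 subnK // modn_small.
have lt_i : k - (l + m) < n by lia.
exists (inl (inr (Ordinal m_gt0))), (inr (Ordinal lt_i)).
by rewrite /tripart_color /= add0n subnK // modn_small.
Qed.

Lemma tripart_interval_cyclic_coloring :
  0 < l -> 0 < m -> 0 < n -> has_interval_cyclic_coloring K (l + m + n).
Proof.
move=> l_gt0 m_gt0 n_gt0.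
apply: (@interval_cyclic_coloring_of_rank _ _ tripart_color tripart_start
  tripart_rank).
- by lia.
- exact: tripart_color_sym.
- by move=> v; rewrite tripart_degree; case: v => [[i|j]|k]; lia.
- exact: tripart_color_rank.
- exact: tripart_rank_lt.
- exact: tripart_rank_inj.
- by move=> k; apply: tripart_color_onto.
Qed.

End Tripartite.

Theorem theorem31 (l m n : nat) (hl : 0 < l) (hm : 0 < m) (hn : 0 < n) :
  exists K_Nc : Nc (complete_tripartite l m n), w_c K_Nc <= l + m + n.
Proof.
have Kt := tripart_interval_cyclic_coloring hl hm hn.
by exists (ex_intro _ _ Kt); apply: w_c_le.
Qed.
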